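(* Let $g\in\mathcal{C}[0,1]$ and let $A:\mathbb{R}\to\mathbb{R}$ satisfy: (A1) $A$ is continuous; (A2) there exists a function $f\in\mathcal{F}$ such that $f(|Ax-Ay|)\le|x-y|\le|Ax-Ay|$ for all $x,y\in\mathbb{R}$. Then the problem $$A(u''(t))-\sin(u(t))=g(t)\ \text{ for } t\in[0,1],\qquad u(0)=0,\quad u(1)=0,$$ has a unique solution in $\mathcal{C}^2[0,1]$ and, moreover, this problem is generalized Ulam-Hyers stable.
   Context: $\mathbb{R}_+=[0,\infty)$. $\mathcal{F}$ is the family of all functions $f:\mathbb{R}_+\to\mathbb{R}_+$ such that $f(r)=0$ if and only if $r=0$, and $f$ is nondecreasing. $\mathcal{C}[0,1]$ denotes the continuous real functions on $[0,1]$ with norm $\|u\|_\infty=\max_{t\in[0,1]}|u(t)|$, and $\mathcal{C}^2[0,1]$ the functions $u:[0,1]\to\mathbb{R}$ with $u''\in\mathcal{C}[0,1]$. Let $X=\{u\in\mathcal{C}^2[0,1]:u(0)=u(1)=0\}$ with the norm $\|u\|_*=\max\{\|u\|_\infty,\|u'\|_\infty,\|u''\|_\infty\}$, and $Y=(\mathcal{C}[0,1],\|\cdot\|_\infty)$. Define $T,S:X\to Y$ by $T(u)(t)=A(u''(t))$ and $S(u)(t)=\sin(u(t))+g(t)$, so that the boundary value problem is the coincidence problem of finding $u\in X$ with $T(u)=S(u)$. The problem is generalized Ulam-Hyers stable if there exists $\psi:\mathbb{R}_+\to\mathbb{R}_+$ increasing, continuous at $0$, with $\psi(0)=0$, such that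 for every $\varepsilon>0$ and every $w^*\in X$ with $\|T(w^* )-S(w^* )\|_\infty\le\varepsilon$ there exists a solution $z^*\in X$ of $T(z^* )=S(z^* )$ such that $\|w^*-z^*\|_*\le\psi(\varepsilon)$. *)

(* Defs.v *)
From HB Require Import structures.
From mathcomp Require Import all_boot all_order all_algebra.
From mathcomp Require Import all_classical all_reals all_analysis.

Set Implicit Arguments.
Unset Strict Implicit.
Unset Printing Implicit Defensive.

Import Order.TTheory GRing.Theory Num.Theory.
Import numFieldNormedType.Exports.

Local Open Scope classical_set_scope.
Local Open Scope ring_scope.

(* Functions on [0, 1] (resp. on [0, +oo[) are represented by total functions
   R -> R of which only the values on `[0, 1] (resp. `[0, +oo[) matter: every
   notion below depends on those values only, and equality of functions on
   [0, 1] is {in `[0, 1], _ =1 _}. *)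

Section Defs.
Context {R : realType}.
Implicit Types (f g u w z psi A : R -> R) (T S : (R -> R) -> (R -> R)).

Definition comparison_family f : Prop :=
  [/\ {in `[0, +oo[, forall r, 0 <= f r},
      {in `[0, +oo[, forall r, f r = 0 <-> r = 0} &
      {in `[0, +oo[ &, {homo f : x y / x <= y}}].

Definition continuous01 u : Prop := {within `[0, 1], continuous u}.

(* Difference quotients are restricted to s in [0, 1], so that derivatives are
   one-sided at 0 and 1. *)
Definition quotient01 u (t s : R) : R := (u s - u t) / (s - t).

Definition differentiable01 u : Prop :=
  {in `[0, 1], forall t, cvg (quotient01 u t @ within `[0, 1] t^')}.

Definition derivative01 u (t : R) : R :=
  lim (quotient01 u t @ within `[0, 1] t^').

Definition C2_01 u : Prop :=
  [/\ differentiable01 u, differentiable01 (derivative01 u) &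
      continuous01 (derivative01 (derivative01 u))].

Definition supnorm01 u : R := sup [set `|u t| | t in `[0, 1]].

Definition spaceX u : Prop := [/\ C2_01 u, u 0 = 0 & u 1 = 0].

Definition normX u : R :=
  Num.max (supnorm01 u)
    (Num.max (supnorm01 (derivative01 u))
             (supnorm01 (derivative01 (derivative01 u)))).

Definition opT A u : R -> R := fun t => A (derivative01 (derivative01 u) t).

Definition opS g u : R -> R := fun t => sin (u t) + g t.

Definition gen_Ulam_Hyers_stable T S : Prop :=
  exists psi : R -> R,
    [/\ {in `[0, +oo[, forall r, 0 <= psi r},
        {in `[0, +oo[ &, {homo psi : x y / x < y}},
        psi x @[x --> within `[0, +oo[ (nbhs (0 : R))] --> psi 0,
        psi 0 = 0 &
        forall (eps : R) (w : R -> R), 0 < eps -> spaceX w ->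
          supnorm01 (T w \- S w) <= eps ->
          exists z : R -> R,
            [/\ spaceX z, {in `[0, 1], T z =1 S z} &
                normX (w \- z) <= psi eps]].

Definition bvp_solution A g u : Prop :=
  [/\ C2_01 u,
      {in `[0, 1], forall t,
         A (derivative01 (derivative01 u) t) - sin (u t) = g t},
      u 0 = 0 & u 1 = 0].

End Defs.

(* Main.v *)
Require Import Defs.
From HB Require Import structures.
From mathcomp Require Import all_boot all_order all_algebra.
From mathcomp Require Import all_classical all_reals all_analysis.
From mathcomp Require Import lra.

Import Order.TTheory GRing.Theory Num.Theory.
Import numFieldNormedType.Exports.

Set Implicit Arguments.
Unset Strict Implicit.
Unset Printing Implicit Defensive.

Local Open Scope classical_set_scope.
Local Open Scope ring_scope.

(** The inequality |x - y| <= |A x - A y| makes the continuous map A a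
    bijection of the line whose inverse B is 1-Lipschitz
    ([expansive_surjective]), so that the problem reads
    u'' = B (sin u + g) with u 0 = u 1 = 0.

    Everything rests on one estimate, [dirichlet_bounds]: if d vanishes at 0
    and 1 and |d''| <= K, then |d'| <= K (by Rolle d' vanishes somewhere) and
    |d| <= K / 2 (integrate |d'| <= K from the nearest end point).

    Uniqueness and stability are the same computation ([expansive_stability]).
    Let z be a solution, let w satisfy the boundary conditions and the equation
    up to an error eps, and put d = w - z.  Then
      |d''| <= |A w'' - A z''| <= eps + |sin w - sin z| <= eps + |d|
            <= eps + (sup |d''|) / 2,
    hence sup |d''| <= 2 eps, and the estimate bounds all three norms of d by
    2 eps.  With eps = 0 this is uniqueness; in general it is stability with
    psi r = 2 r.

    For existence, let Phi u be the solution of v'' = B (sin u + g),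
    v 0 = v 1 = 0, obtained by integrating twice
    ([exists_dirichlet_solution]).  As B and sin are 1-Lipschitz,
    [dirichlet_bounds] makes Phi a 1/2-contraction for the sup norm on [0, 1],
    and its fixed point ([contraction01_fixpoint]) solves the problem. *)

(** * One-sided derivatives on [0, 1] *)
Section OneSidedDerivative.
Context {R : realType}.
Implicit Types (u v du dv h : R -> R) (t s : R).

Definition has_deriv01 u du : Prop :=
  {in `[0, 1], forall t, quotient01 u t s @[s --> within `[0, 1] t^'] --> du t}.

(** The two restrictions of the filter, to [0, 1] and away from t, become plain
    hypotheses on s, which lets neighborhoods of t be shrunk or translated when
    difference quotients are compared. *)
Lemma has_deriv01P u du :
  has_deriv01 u du <->
  {in `[0, 1], forall t, forall e, 0 < e -> \forall s \near t,
     s \in `[0, 1] -> s != t -> `|du t - quotient01 u t s| <= e}.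
Proof.
split=> du_t t t01.
- move=> e e0; have /cvgrPdist_le/(_ e e0) := du_t t t01.
  rewrite near_withinE /dnbhs near_withinE; apply: filterS => s H s01 st.
  by apply: H.
- apply/cvgrPdist_le => e e0.
  rewrite near_withinE /dnbhs near_withinE.
  have := du_t t t01 e e0; apply: filterS => s H st s01.
  by apply: H => //.
Qed.

(** Limits along this filter are unique because every point of [0, 1] is
    approached from inside: from the right if t < 1, from the left if t = 1. *)
Lemma dnbhs01_proper t : t \in `[0, 1] -> ProperFilter (within `[0, 1] t^').
Proof.
rewrite in_itv/= => /andP[t0 t1].
apply: Build_ProperFilter_ex.
rewrite /within/= => P; rewrite /dnbhs near_withinE => nP.
have [t_lt1|t_ge1] := ltP t 1.
- have : \forall s \near t^'+, s < 1 by exact: nbhs_right_lt.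
  have : \forall s \near t^'+, `[0, 1]%classic s -> P s.
    rewrite /at_right near_withinE; move: nP; apply: filterS => s + st.
    by apply; rewrite gt_eqF.
  move=> H1 H2.
  near t^'+ => s; exists s; apply: (near H1) => //=.
  rewrite in_itv/=; apply/andP; split; last first.
    by apply: ltW; near: s.
  by rewrite (le_trans t0)//; near: s; apply: nbhs_right_ge.
- have : \forall s \near t^'-, 0 < s.
    by apply: nbhs_left_gt; rewrite (lt_le_trans _ t_ge1).
  have : \forall s \near t^'-, `[0, 1]%classic s -> P s.
    rewrite /at_left near_withinE; move: nP; apply: filterS => s + st.
    by apply; rewrite lt_eqF.
  move=> H1 H2.
  near t^'- => s; exists s; apply: (near H1) => //=.
  rewrite in_itv/=; apply/andP; split.
    by apply: ltW; near: s.
  by rewrite (le_trans _ t1)//; near: s; apply: nbhs_left_le.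
Unshelve. all: by end_near. Qed.

Lemma has_deriv01_derivative u du : has_deriv01 u du ->
  differentiable01 u /\ {in `[0, 1], derivative01 u =1 du}.
Proof.
move=> d; split=> t t01; first by apply/cvg_ex; exists (du t); exact: d.
have := dnbhs01_proper t01 => pf.
by apply: cvg_lim => //; exact: d.
Qed.

Lemma differentiable01_has_deriv u : differentiable01 u ->
  has_deriv01 u (derivative01 u).
Proof. by move=> d t t01; exact: d. Qed.

(** The restricted quotients see only the values on [0, 1], so derivatives can
    be replaced by convenient representatives before differentiating again. *)
Lemma eq_has_deriv01 u v du dv :
  {in `[0, 1], u =1 v} -> {in `[0, 1], du =1 dv} ->
  has_deriv01 u du -> has_deriv01 v dv.
Proof.
move=> uv dudv /has_deriv01P d; apply/has_deriv01P => t t01 e e0.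
have := d t t01 e e0; apply: filterS => s H s01 st.
by rewrite -dudv// /quotient01 -!uv//; exact: H.
Qed.

Lemma has_deriv01B u v du dv : has_deriv01 u du -> has_deriv01 v dv ->
  has_deriv01 (u \- v) (du \- dv).
Proof.
move=> d d' t t01.
have -> : quotient01 (u \- v) t = quotient01 u t \- quotient01 v t.
  by apply/funext => s; rewrite /quotient01/= -mulrBl; congr (_ / _); lra.
by apply: cvgB; [exact: d|exact: d'].
Qed.

Lemma is_derive_has_deriv01 u du :
  {in `[0, 1], forall t, is_derive t 1 u (du t)} -> has_deriv01 u du.
Proof.
move=> d; apply/has_deriv01P => t t01 e e0.
have [du_t du_tE] := d t t01.
have : (fun h : R => h^-1 *: ((u \o shift t) (h *: (1:R)) - u t)) @ 0^' --> du t.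
  by rewrite -du_tE; exact: du_t.
move=> /cvgrPdist_le/(_ e e0).
rewrite /dnbhs near_withinE => /nbhs_ballP[r /= r0 H].
apply/nbhs_ballP; exists r => //= s ts s01 st.
have := H (s - t); rewrite /ball/= sub0r normrN distrC => /(_ ts).
rewrite subr_eq0 => /(_ st).
by rewrite /quotient01 /shift/= /GRing.scale/= mulr1 subrK mulrC.
Qed.

(** Inside the open interval the restriction of the quotient to [0, 1] is
    invisible; this gives access to Rolle and to the mean value theorem. *)
Lemma has_deriv01_is_derive u du : has_deriv01 u du ->
  {in `]0, 1[, forall t, is_derive t 1 u (du t)}.
Proof.
move=> /has_deriv01P d t t01.
have t01' : t \in `[0, 1] by apply: subset_itv_oo_cc.
suff H : (fun h : R => h^-1 *: ((u \o shift t) (h *: (1:R)) - u t)) @ 0^' --> du t.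
  by apply: DeriveDef; [apply/cvg_ex; exists (du t)|exact: cvg_lim H].
apply/cvgrPdist_le => e e0.
have := d t t01' e e0.
have : \forall s \near t, s \in `]0, 1[ by exact: near_in_itvoo.
move=> H1 H2.
have : \forall s \near t, s != t -> `|du t - quotient01 u t s| <= e.
  near=> s => st; apply: (near H2 s) => //.
  by apply: subset_itv_oo_cc; apply: (near H1 s).
move=> /nbhs_ballP[r /= r0 H].
rewrite /dnbhs near_withinE; apply/nbhs_ballP; exists r => //= h.
rewrite /ball/= sub0r normrN => hr h0.
have := H (h + t); rewrite /ball/= opprD addrC subrK normrN => /(_ hr).
rewrite -subr_eq0 addrK => /(_ h0).
by rewrite /quotient01 /shift/= /GRing.scale/= mulr1 addrK mulrC.
Unshelve. all: by end_near. Qed.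

Lemma has_deriv01_continuous u du : has_deriv01 u du -> continuous01 u.
Proof.
move=> /has_deriv01P d; apply/subspace_continuousP => t /= t01.
apply/cvgrPdist_le => e e0; rewrite near_withinE.
pose M := `|du t| + 1.
have M0 : 0 < M by rewrite /M ltr_wpDl.
have near_t : \forall s \near t, `|t - s| <= e / M.
  by have /cvgrPdist_le := @cvg_id _ (nbhs t); apply; rewrite divr_gt0.
have := d t t01 1 ltr01 => H.
near=> s => s01.
have [->|st] := eqVneq s t; first by rewrite subrr normr0 ltW.
have -> : u t - u s = quotient01 u t s * (t - s).
  rewrite /quotient01 -(opprB s t) -[in LHS](opprB (u s)) mulrN divfK//.
  by rewrite subr_eq0.
rewrite normrM -(divfK (lt0r_neq0 M0) e) mulrC.
apply: ler_pM => //; first by apply: (near near_t s).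
have := near H s _ s01 st => /(_ ltac:(by [])) dq.
rewrite /M -[quotient01 u t s](subKr (du t)) (le_trans (ler_normB _ _))//.
by rewrite lerD2l.
Unshelve. all: by end_near. Qed.

End OneSidedDerivative.

(** * Sup norms and the basic estimate *)
Section SupNorm.
Context {R : realType}.
Implicit Types (u v du : R -> R) (K t s : R).

Lemma eq_continuous01 u v :
  {in `[0, 1], u =1 v} -> continuous01 u -> continuous01 v.
Proof.
by move=> uv; apply: subspace_eq_continuous => t /set_mem t01; exact: uv.
Qed.

Lemma continuous01_comp (f u : R -> R) :
  continuous f -> continuous01 u -> continuous01 (f \o u).
Proof.
move=> cf /subspace_continuousP cu; apply/subspace_continuousP => t t01.
by apply: continuous_cvg; [exact: cf|exact: cu].
Qed.

(** Continuity makes the set of values bounded, so that its [sup] is a genuine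
    supremum and not a default value. *)
Lemma le_supnorm01 u t : continuous01 u -> t \in `[0, 1] ->
  `|u t| <= supnorm01 u.
Proof.
move=> cu t01; apply: ub_le_sup; last by exists t.
have /compact_bounded[M [_ Mu]] := continuous_compact cu (@segment_compact _ 0 1).
exists (M + 1) => _ [s s01 <-]; apply: (Mu (M + 1)); first by rewrite ltrDl.
by exists s.
Qed.

Lemma supnorm01_le u K :
  {in `[0, 1], forall t, `|u t| <= K} -> supnorm01 u <= K.
Proof.
move=> uK; apply: ge_sup; last by move=> _ [t t01 <-]; exact: uK.
by exists `|u 0|, 0 => //=; rewrite in_itv/= lexx ler01.
Qed.

Lemma lipschitz_has_deriv01 u du K : has_deriv01 u du ->
  {in `[0, 1], forall t, `|du t| <= K} ->
  {in `[0, 1] &, forall s t, `|u t - u s| <= K * `|t - s|}.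
Proof.
move=> u_du duK s t.
wlog st : s t / s <= t.
  move=> h s01 t01; have [st|/ltW ts] := leP s t; first exact: h.
  by rewrite distrC (distrC t); exact: h.
rewrite !in_itv/= => /andP[s0 s1] /andP[t0 t1].
have [|r|c cst ->] := @MVT_segment _ u du s t st.
- move=> c; rewrite in_itv/= => /andP[sc ct].
  apply: (has_deriv01_is_derive u_du); rewrite in_itv/=.
  by rewrite (le_lt_trans s0 sc) (lt_le_trans ct t1).
- apply: continuous_subspaceW (has_deriv01_continuous u_du) r.
  move=> x /=; rewrite !in_itv/= => /andP[sx xt].
  by rewrite (le_trans s0 sx) (le_trans xt t1).
- rewrite normrM ler_wpM2r// duK//; move: cst; rewrite !in_itv/= => /andP[sc ct].
  by rewrite (le_trans s0 sc) (le_trans ct t1).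
Qed.

(** The first bound starts from a zero c of d1 given by Rolle.  For the second,
    d is K-Lipschitz and vanishes at both ends, so |d t| is at most K t and
    K (1 - t), whose minimum is at most K / 2.  A constant below 1 in front of
    K is what makes the problem contractive. *)
Lemma dirichlet_bounds (d d1 d2 : R -> R) K :
  has_deriv01 d d1 -> has_deriv01 d1 d2 -> d 0 = 0 -> d 1 = 0 ->
  {in `[0, 1], forall t, `|d2 t| <= K} ->
  {in `[0, 1], forall t, `|d1 t| <= K} /\ {in `[0, 1], forall t, `|d t| <= K / 2}.
Proof.
move=> dd1 d1d2 d_0 d_1 d2K.
have m0 : (0 : R) \in `[0, 1] by rewrite in_itv/= lexx ler01.
have m1 : (1 : R) \in `[0, 1] by rewrite in_itv/= lexx ler01.
have K0 : 0 <= K by exact: le_trans (d2K 0 m0).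
have [c c01 [dc dcE]] : exists2 c : R, c \in `]0, 1[ & is_derive c 1 d 0.
  apply: Rolle; rewrite ?d_0 ?d_1//; last exact: has_deriv01_continuous dd1.
  by move=> x /(has_deriv01_is_derive dd1)[].
have d1c : d1 c = 0.
  by have [_ <-] := has_deriv01_is_derive dd1 c01.
have d1K : {in `[0, 1], forall t, `|d1 t| <= K}.
  move=> t t01.
  have c01' : c \in `[0, 1] by apply: subset_itv_oo_cc.
  rewrite -[d1 t]subr0 -d1c.
  rewrite (le_trans (lipschitz_has_deriv01 d1d2 d2K c01' t01))//.
  rewrite -[leRHS]mulr1 ler_wpM2l//.
  move: c01' t01; rewrite !in_itv/= => /andP[? ?] /andP[? ?].
  by rewrite ler_norml; apply/andP; split; lra.
split=> // t t01.
have := lipschitz_has_deriv01 dd1 d1K m0 t01.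
have := lipschitz_has_deriv01 dd1 d1K t01 m1.
move: t01; rewrite in_itv/= => /andP[t0 t1].
rewrite d_0 d_1 sub0r normrN !subr0 (ger0_norm t0).
by rewrite [`|1 - t|]ger0_norm ?subr_ge0//; lra.
Qed.

End SupNorm.

(** * Uniqueness and stability *)
Section Stability.
Context {R : realType}.
Implicit Types (u v w z g A : R -> R) (K eps : R).

Lemma sin_lipschitz (x y : R) : `|sin x - sin y| <= `|x - y|.
Proof.
wlog yx : x y / y <= x.
  move=> h; have [yx|/ltW xy] := leP y x; first exact: h.
  by rewrite distrC (distrC x); exact: h.
have [|c _ ->] := @MVT_segment _ sin cos y x yx.
  by apply: continuous_subspaceT; exact: continuous_sin.
by rewrite normrM ler_piMl// cos_max.
Qed.

Lemma C2_01_has_deriv u : C2_01 u ->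
  has_deriv01 u (derivative01 u) /\
  has_deriv01 (derivative01 u) (derivative01 (derivative01 u)).
Proof. by case=> u1 u2 _; split; exact: differentiable01_has_deriv. Qed.

(** Iterated derivatives are computed from explicit candidates; the candidates
    are only compared on [0, 1], where [derivative01] is determined. *)
Lemma has_deriv01_C2 u du ddu : has_deriv01 u du -> has_deriv01 du ddu ->
  continuous01 ddu ->
  [/\ C2_01 u, {in `[0, 1], derivative01 u =1 du} &
      {in `[0, 1], derivative01 (derivative01 u) =1 ddu}].
Proof.
move=> u1 u2 ddu_cont.
have [udiff uE] := has_deriv01_derivative u1.
have u2' : has_deriv01 (derivative01 u) ddu.
  by apply: eq_has_deriv01 u2 => // t t01; rewrite uE.
have [dudiff duE] := has_deriv01_derivative u2'.
split=> //; split=> //; apply: eq_continuous01 ddu_cont => t t01.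
by rewrite duE.
Qed.

(** The sup K of |w'' - z''| is controlled by itself, K <= eps + K / 2,
    because A expands distances and sin w - sin z is at most K / 2; so
    K <= 2 eps. *)
Lemma expansive_stability A g w z eps :
  (forall x y, `|x - y| <= `|A x - A y|) ->
  spaceX w -> spaceX z ->
  {in `[0, 1], forall t, `|opT A w t - opS g w t| <= eps} ->
  {in `[0, 1], opT A z =1 opS g z} ->
  normX (w \- z) <= 2 * eps /\ {in `[0, 1], forall t, `|w t - z t| <= 2 * eps}.
Proof.
move=> A_exp [wC2 w0 w1] [zC2 z0 z1] w_eps z_sol.
have [[dw ddw] [dz ddz]] := (C2_01_has_deriv wC2, C2_01_has_deriv zC2).
have dd1 := has_deriv01B dw dz; have dd2 := has_deriv01B ddw ddz.
set d1 := (derivative01 w \- derivative01 z) in dd1 dd2.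
set d2 := (_ \- _) in dd2.
have d2_cont : continuous01 d2.
  case: wC2 zC2 => _ _ cw [_ _ cz].
  exact: within_continuousB.
have [_ d1E d2E] := has_deriv01_C2 dd1 dd2 d2_cont.
have d_0 : (w \- z) 0 = 0 by rewrite /= w0 z0 subrr.
have d_1 : (w \- z) 1 = 0 by rewrite /= w1 z1 subrr.
pose K := supnorm01 d2.
have d2K : {in `[0, 1], forall t, `|d2 t| <= K}.
  by move=> t t01; exact: le_supnorm01.
have [d1K dK] := dirichlet_bounds dd1 dd2 d_0 d_1 d2K.
have K_le : K <= eps + K / 2.
  apply: supnorm01_le => t t01.
  apply: le_trans (A_exp _ _) _.
  have -> : A (derivative01 (derivative01 w) t) - A (derivative01 (derivative01 z) t)
      = (opT A w t - opS g w t) + (sin (w t) - sin (z t)).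
    rewrite -[A (derivative01 (derivative01 z) t)]/(opT A z t) z_sol//.
    by rewrite /opT /opS; lra.
  rewrite (le_trans (ler_normD _ _))// lerD ?w_eps//.
  exact: le_trans (sin_lipschitz _ _) (dK t t01).
have K_eps : K <= 2 * eps by lra.
have K0 : 0 <= K.
  by apply: le_trans (d2K 0 _) => //; rewrite in_itv/= lexx ler01.
have d_eps : {in `[0, 1], forall t, `|(w \- z) t| <= 2 * eps}.
  by move=> t t01; apply: le_trans (dK t t01) _; lra.
split=> //; rewrite /normX !ge_max; apply/and3P; split.
- exact: supnorm01_le.
- by apply: supnorm01_le => t t01; rewrite d1E// (le_trans (d1K t t01)).
- by apply: supnorm01_le => t t01; rewrite d2E// (le_trans (d2K t t01)).
Qed.

(** Stability assumes a bound on the sup norm of the residual; by continuity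
    it holds pointwise, which is what [expansive_stability] consumes. *)
Lemma continuous01_residual A g w : continuous A -> continuous01 g ->
  spaceX w -> continuous01 (opT A w \- opS g w).
Proof.
move=> cA cg [wC2 _ _].
have [dw _] := C2_01_has_deriv wC2.
apply: within_continuousB; last first.
  apply: within_continuousD => //.
  apply: (continuous01_comp (@continuous_sin R)).
  exact: has_deriv01_continuous dw.
by case: wC2 => _ _ cw; exact: continuous01_comp cA cw.
Qed.

Lemma bvp_solutionP A g u : bvp_solution A g u <->
  spaceX u /\ {in `[0, 1], opT A u =1 opS g u}.
Proof.
split=> [[uC2 uE u0 u1]|[[uC2 u0 u1] uE]]; split=> // t t01.
  by rewrite /opT /opS -uE//; lra.
by have := uE t t01; rewrite /opT /opS => ->; lra.
Qed.

End Stability.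

(** * Double integration and contractions *)
Section Existence.
Context {R : realType}.
Implicit Types (u v h A B : R -> R) (K t : R).

(** The retraction of the line onto [0, 1]: composing with it extends a
    function continuous on [0, 1] to the whole line, so that the two-sided
    fundamental theorem of calculus applies at the end points as well. *)
Definition clamp01 t : R := Num.max 0 (Num.min 1 t).

Lemma clamp01_itv t : clamp01 t \in `[0, 1].
Proof. by rewrite in_itv/= /clamp01 le_max lexx/= ge_max ler01 ge_min lexx. Qed.

Lemma clamp01_id t : t \in `[0, 1] -> clamp01 t = t.
Proof.
by rewrite in_itv/= => /andP[t0 t1]; rewrite /clamp01 min_r// max_r.
Qed.

Lemma continuous_clamp01 : continuous clamp01.
Proof.
move=> t; apply: (@continuous_max R R (cst 0) (fun x => Num.min 1 x)).
  exact: cvg_cst.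
by apply: (@continuous_min R R (cst 1) id); [exact: cvg_cst|exact: cvg_id].
Qed.

Lemma continuous_comp_clamp01 h : continuous01 h -> continuous (h \o clamp01).
Proof.
move=> /subspace_continuousP ch t.
have clamp_t : clamp01 s @[s --> t] --> within `[0, 1] (nbhs (clamp01 t)).
  move=> P; rewrite /within/= => nP.
  apply: (@filterS _ (nbhs t) _ _ _ _ (@continuous_clamp01 t _ nP)) => s; apply.
  exact: clamp01_itv.
exact: cvg_comp clamp_t (ch (clamp01 t) (clamp01_itv t)).
Qed.

Lemma exists_primitive01 h : continuous01 h -> exists H, has_deriv01 H h.
Proof.
move=> ch; have chc := continuous_comp_clamp01 ch.
pose mu := @lebesgue_measure R.
(* Starting the integral at -1 makes 0 an interior point. *)
exists (fun x => (\int[mu]_(s in `[-1, x]) (h \o clamp01) s)%R).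
apply: eq_has_deriv01 (fun _ _ => erefl) _ _.
  by move=> t t01; rewrite -{2}(clamp01_id t01).
apply: is_derive_has_deriv01 => t; rewrite in_itv/= => /andP[t0 t1].
have [||||dF FE] := @continuous_FTC1_closed _ (h \o clamp01) (-1) t 2.
- by lra.
- apply: continuous_compact_integrable; first exact: segment_compact.
  exact: continuous_subspaceT.
- by lra.
- exact: chc.
by apply: DeriveDef => //; rewrite -derive1E.
Qed.

Lemma exists_dirichlet_solution h : continuous01 h ->
  exists u, spaceX u /\ {in `[0, 1], derivative01 (derivative01 u) =1 h}.
Proof.
move=> ch.
have [H dH] := exists_primitive01 ch.
have [G dG] := exists_primitive01 (has_deriv01_continuous dH).
(* Subtracting the chord of G restores the boundary values and leaves the
   second derivative unchanged. *)
pose c := G 1 - G 0.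
have daff : has_deriv01 (fun t => G 0 + t * c) (fun=> c).
  apply: is_derive_has_deriv01 => t _.
  by apply: is_derive_eq; rewrite add0r mul1r scaler0 add0r /GRing.scale/= mulr1.
have dc : has_deriv01 (fun=> c) (fun=> 0).
  by apply: is_derive_has_deriv01 => t _; exact: is_derive_cst.
have [] := has_deriv01_C2 (has_deriv01B dG daff) (has_deriv01B dH dc).
  by apply: within_continuousB => //; apply: continuous_subspaceT => t; exact: cvg_cst.
move=> uC2 _ uE; exists (G \- (fun t => G 0 + t * c)); split.
  by split=> //=; rewrite /c; lra.
by move=> t t01; rewrite uE//= subr0.
Qed.

(** Uniform limits of continuous functions, by the usual three-epsilon
    argument. *)
Lemma continuous01_approx u :
  (forall e, 0 < e -> exists2 v, continuous01 v &
     {in `[0, 1], forall t, `|u t - v t| <= e}) ->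
  continuous01 u.
Proof.
move=> uv; apply/subspace_continuousP => t t01; apply/cvgrPdist_le => e e0.
have e3 : 0 < e / 3 by lra.
have [v /subspace_continuousP/(_ t t01)/cvgrPdist_le/(_ _ e3) cv ve] := uv _ e3.
rewrite near_withinE in cv *; move: cv; apply: filterS => s cv s01.
have := ve t t01; have := ve s s01; have := cv s01.
rewrite /from_subspace/= !ler_norml.
by move=> /andP[? ?] /andP[? ?] /andP[? ?]; apply/andP; split; lra.
Qed.

(** Picard iteration from 0.  The iterates stay within C = |u_1| / (1 - q) of
    u_0, since C solves q C + |u_1| = C; applying Phi n times gives
    |u_(m + n) - u_n| <= q^n C, so the iterates converge uniformly.  Phi acts on
    functions on the whole line but is controlled only on [0, 1], hence the
    pointwise formulation in place of a norm. *)
Lemma contraction01_fixpoint (Phi : (R -> R) -> R -> R) (q : R) :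
  0 <= q -> q < 1 ->
  (forall u, continuous01 u -> continuous01 (Phi u)) ->
  (forall u v K, continuous01 u -> continuous01 v ->
     {in `[0, 1], forall t, `|u t - v t| <= K} ->
     {in `[0, 1], forall t, `|Phi u t - Phi v t| <= q * K}) ->
  exists2 u, continuous01 u & {in `[0, 1], Phi u =1 u}.
Proof.
move=> q0 q1 Phi_cont Phi_q.
pose u_ n := iter n Phi (fun=> 0).
have u_cont n : continuous01 (u_ n).
  elim: n => [|n ih]; last exact: Phi_cont.
  by apply: continuous_subspaceT => t; exact: cvg_cst.
pose C := supnorm01 (u_ 1%N) / (1 - q).
have u0_C n : {in `[0, 1], forall t, `|u_ n t - u_ 0%N t| <= C}.
  have u1_C t : t \in `[0, 1] -> `|u_ 1%N t| <= C - q * C.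
    move=> t01; rewrite (le_trans (le_supnorm01 (u_cont _) t01))//.
    by rewrite -[X in X - _]mul1r -mulrBl mulrC divfK// subr_eq0 gt_eqF.
  have C0 : 0 <= C.
    rewrite divr_ge0 ?subr_ge0 ?(ltW q1)//.
    apply: le_trans (le_supnorm01 (u_cont _) (t := 0) _) => //.
    by rewrite in_itv/= lexx ler01.
  elim: n => [|n ih] t t01; first by rewrite subrr normr0.
  have := Phi_q _ _ _ (u_cont n) (u_cont 0%N) ih t t01.
  have := u1_C t t01.
  rewrite -[Phi (u_ n) t]/(u_ n.+1 t) -[Phi (u_ 0%N) t]/(u_ 1%N t).
  rewrite [u_ 0%N t]/(0) subr0.
  by rewrite !ler_norml => /andP[? ?] /andP[? ?]; apply/andP; split; lra.
have u_geo n m : {in `[0, 1], forall t, `|u_ (m + n)%N t - u_ n t| <= q ^+ n * C}.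
  elim: n => [|n ih] t t01; first by rewrite mul1r addn0; exact: u0_C.
  by rewrite addnS exprS -mulrA; exact: Phi_q ih t t01.
have qC_cvg0 : q ^+ n * C @[n --> \oo] --> 0.
  rewrite -[X in _ --> X](mul0r C); apply: cvgM; last exact: cvg_cst.
  by apply: cvg_expr; rewrite ger0_norm.
have small e : 0 < e -> exists N, q ^+ N * C <= e.
  move=> e0; have /cvgrPdist_le/(_ e e0)[N _ /(_ N (leqnn N))] := qC_cvg0.
  by rewrite sub0r normrN => /(le_trans (ler_norm _)); exists N.
have u_cvg t : t \in `[0, 1] -> cvg (u_ ^~ t @ \oo).
  move=> t01; apply/cauchy_cvgP/cauchy_exP => e e0.
  have e2 : 0 < e / 2 by rewrite divr_gt0.
  have [N NE] := small _ e2; exists (u_ N t).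
  exists N => // n /= Nn; rewrite /ball/= distrC -(subnK Nn).
  apply: le_lt_trans (u_geo N (n - N)%N t t01) _; lra.
pose u t := lim (u_ ^~ t @ \oo).
have u_lim n : {in `[0, 1], forall t, `|u t - u_ n t| <= q ^+ n * C}.
  move=> t t01.
  have cv : `|u_ m t - u_ n t| @[m --> \oo] --> `|u t - u_ n t|.
    by apply: cvg_norm; apply: cvgB; [exact: u_cvg|exact: cvg_cst].
  apply: cvgr_to_le cv _; exists n => // m /= nm.
  by rewrite -(subnK nm); exact: u_geo.
have cu : continuous01 u.
  apply: continuous01_approx => e /small[N NE]; exists (u_ N) => // t t01.
  exact: le_trans (u_lim N t t01) NE.
exists u => // t t01; apply/eqP; rewrite -subr_eq0 -normr_le0.
apply/ler_addgt0Pl => e e0; rewrite addr0.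
have e2 : 0 < e / 2 by rewrite divr_gt0.
have [N NE] := small _ e2.
have qe : q * (q ^+ N * C) <= e / 2.
  have C0 : 0 <= q ^+ N * C by exact: le_trans (u_lim N t t01).
  by apply: le_trans NE; rewrite ler_piMl// ltW.
have := Phi_q _ _ _ cu (u_cont N) (u_lim N) t t01.
have := u_lim N.+1 t t01.
rewrite exprS -mulrA -[Phi (u_ N) t]/(u_ N.+1 t) !ler_norml.
by move=> /andP[? ?] /andP[? ?]; apply/andP; split; lra.
Qed.

End Existence.

(** * Inverting A and solving the problem *)
Section Expansive.
Context {R : realType}.
Implicit Types (A B g u : R -> R).

(** For large r the values A r and A (- r) are at distance at least r from A 0.
    If both lay on the same side, the intermediate value theorem would give a
    value taken on either side of 0, against injectivity; so they lie on
    opposite sides and A takes all values in between. *)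
Lemma expansive_surjective A : continuous A ->
  (forall x y, `|x - y| <= `|A x - A y|) -> forall y, exists x, A x = y.
Proof.
move=> cA A_exp y.
have A_inj x x' : A x = A x' -> x = x'.
  move=> AE; apply/eqP; rewrite -subr_eq0 -normr_le0.
  by rewrite (le_trans (A_exp x x'))// AE subrr normr0.
pose r := `|y - A 0| + 1.
have r0 : 0 < r by rewrite /r ltr_wpDl.
have y_r : `|y - A 0| <= r by rewrite /r lerDl.
have cAw a b : {within `[a, b], continuous A} by exact: continuous_subspaceT.
have itv0 v : Num.min (A (- r)) (A 0) <= v <= Num.max (A (- r)) (A 0) ->
    exists2 c, c <= 0 & A c = v.
  move=> vr; have [|c cr Ac] := IVT _ (cAw (- r) 0) vr; first by lra.
  by exists c => //; move: cr; rewrite in_itv/= => /andP[].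
have itv1 v : Num.min (A 0) (A r) <= v <= Num.max (A 0) (A r) ->
    exists2 c, 0 <= c & A c = v.
  move=> vr; have [|c cr Ac] := IVT _ (cAw 0 r) vr; first by lra.
  by exists c => //; move: cr; rewrite in_itv/= => /andP[].
have no_fold v : v != A 0 ->
    Num.min (A (- r)) (A 0) <= v <= Num.max (A (- r)) (A 0) ->
    Num.min (A 0) (A r) <= v <= Num.max (A 0) (A r) -> False.
  move=> vA0 /itv0[c c0 Ac] /itv1[c' c'0 Ac'].
  have cc' : c = c' by apply: A_inj; rewrite Ac.
  have c00 : c = 0 by apply/eqP; rewrite eq_le c0 cc' c'0.
  by move: vA0; rewrite -Ac c00 eqxx.
have Ar : r <= `|A r - A 0|.
  by rewrite (le_trans _ (A_exp r 0))// subr0 (ger0_norm (ltW r0)).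
have ANr : r <= `|A (- r) - A 0|.
  by rewrite (le_trans _ (A_exp (- r) 0))// subr0 normrN (ger0_norm (ltW r0)).
suff [c _ Ac] : exists2 c, c \in `[- r, r] & A c = y by exists c.
apply: IVT => //; first by lra.
move: y_r; rewrite ler_norml => /andP[yr1 yr2].
have no_up : A 0 + r <= A (- r) -> A 0 + r <= A r -> False.
  move=> h1 h2; apply: (@no_fold (A 0 + r)).
  - by rewrite gt_eqF// ltrDl.
  - by rewrite ge_min le_max h1 lerDl (ltW r0) orbT.
  - by rewrite ge_min le_max h2 lerDl (ltW r0) orbT.
have no_down : A (- r) <= A 0 - r -> A r <= A 0 - r -> False.
  move=> h1 h2; apply: (@no_fold (A 0 - r)).
  - by rewrite lt_eqF// gtrBl.
  - by rewrite ge_min le_max h1 gerBl (ltW r0) orbT.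
  - by rewrite ge_min le_max h2 gerBl (ltW r0) orbT.
rewrite ge_min le_max.
move: Ar ANr; rewrite !ler_normr => /orP[h1|h1] /orP[h2|h2].
- by exfalso; apply: no_up; lra.
- by apply/andP; split; apply/orP; [left|right]; lra.
- by apply/andP; split; apply/orP; [right|left]; lra.
- by exfalso; apply: no_down; lra.
Qed.

(** The fixed point u is only known to be continuous, and its derivatives are
    read off Phi u, which agrees with u on [0, 1]. *)
Lemma expansive_bvp_exists A g : continuous A -> continuous01 g ->
  (forall x y, `|x - y| <= `|A x - A y|) ->
  exists z, spaceX z /\ {in `[0, 1], opT A z =1 opS g z}.
Proof.
move=> cA cg A_exp.
have /choice[B BK] := expansive_surjective cA A_exp.
have B_lip x y : `|B x - B y| <= `|x - y|.
  by rewrite (le_trans (A_exp _ _))// !BK.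
have cB : continuous B.
  move=> x; apply/cvgrPdist_le => e e0.
  have /cvgrPdist_le/(_ e e0) := @cvg_id _ (nbhs x).
  by apply: filterS => y; apply: le_trans.
have /choice[sol solP] : forall h : R -> R, exists u, continuous01 h ->
    spaceX u /\ {in `[0, 1], derivative01 (derivative01 u) =1 h}.
  move=> h; have [/exists_dirichlet_solution[u uP]|nh] := pselect (continuous01 h).
    by exists u.
  by exists h.
have cS u : continuous01 u -> continuous01 (B \o opS g u).
  move=> cu; apply: (continuous01_comp cB); apply: within_continuousD => //.
  exact: continuous01_comp (@continuous_sin R) cu.
pose Phi u := sol (B \o opS g u).
have PhiP u : continuous01 u -> spaceX (Phi u) /\
    {in `[0, 1], derivative01 (derivative01 (Phi u)) =1 B \o opS g u}.
  by move=> cu; exact: solP (cS u cu).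
have [||||u cu uE] := @contraction01_fixpoint _ Phi 2^-1.
- by lra.
- by lra.
- move=> u /PhiP[[uC2 _ _] _].
  by have [du _] := C2_01_has_deriv uC2; exact: has_deriv01_continuous du.
- move=> u v K cu cv uv.
  have [[uC2 u0 u1] uE] := PhiP u cu; have [[vC2 v0 v1] vE] := PhiP v cv.
  have [[du ddu] [dv ddv]] := (C2_01_has_deriv uC2, C2_01_has_deriv vC2).
  have [||t t01|_ H] := dirichlet_bounds (has_deriv01B du dv)
    (has_deriv01B ddu ddv) _ _ (K := K).
  + by rewrite /= u0 v0 subrr.
  + by rewrite /= u1 v1 subrr.
  + rewrite /= uE// vE//= (le_trans (B_lip _ _))// /opS opprD addrACA subrr addr0.
    by rewrite (le_trans (sin_lipschitz _ _))// uv.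
  + by move=> t t01; rewrite mulrC; exact: H.
have [zX zE] := PhiP u cu; exists (Phi u); split=> // t t01.
by rewrite /opT zE//= BK /opS uE.
Qed.

End Expansive.

Theorem proposition5p1 (R : realType) (g A : R -> R)
    (hg : continuous01 g)
    (hA1 : continuous A)
    (hA2 : exists f : R -> R, comparison_family f /\
       forall x y : R,
         f `|A x - A y| <= `|x - y| /\ `|x - y| <= `|A x - A y|) :
  (exists u : R -> R, bvp_solution A g u /\
     forall v : R -> R, bvp_solution A g v -> {in `[0, 1], v =1 u}) /\
  gen_Ulam_Hyers_stable (opT A) (opS g).
Proof.
have A_exp x y : `|x - y| <= `|A x - A y| by have [f [_ /(_ x y)[]]] := hA2.
have [u [uX uE]] := expansive_bvp_exists hA1 hg A_exp.
split.
  exists u; split=> [|v /bvp_solutionP[vX vE] t t01]; first exact/bvp_solutionP.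
  have res0 : {in `[0, 1], forall t, `|opT A v t - opS g v t| <= 0}.
    by move=> s s01; rewrite vE// subrr normr0.
  have [_ /(_ t t01)] := expansive_stability A_exp vX uX res0 uE.
  by rewrite mulr0 normr_le0 subr_eq0 => /eqP.
exists (fun r => 2 * r); split=> //.
- by move=> r; rewrite in_itv/= andbT => r0; rewrite mulr_ge0.
- by move=> x y _ _ xy; rewrite ltr_pM2l.
- apply: cvg_within_filter; apply: cvgM; first exact: cvg_cst.
  exact: cvg_id.
- by rewrite mulr0.
move=> eps w eps0 wX w_eps; exists u; split=> //.
have res : {in `[0, 1], forall t, `|opT A w t - opS g w t| <= eps}.
  move=> t t01; apply: le_trans w_eps.
  exact: (le_supnorm01 (continuous01_residual hA1 hg wX) t01).
by have [] := expansive_stability A_exp wX uX res uE.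
Qed.
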